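(* Let $K$ be a field, $\lambda\in K$, and let $(A,\mu,1,\alpha,\beta)$ be a unitary BiHom-associative algebra over $K$ with $\alpha,\beta$ bijective. Let $\psi,\omega:A\to A$ be linear maps such that any two of $\alpha,\beta,\psi,\omega$ commute, $\psi(ab)=\psi(a)\psi(b)$, $\omega(ab)=\omega(a)\omega(b)$ for all $a,b\in A$, and $\psi(1)=1=\omega(1)$. Let $r=r^1\otimes r^2\in A\otimes A$ satisfy $(f\otimes f)(r)=r$ for each $f\in\{\alpha,\beta,\psi,\omega\}$, and put $$\Delta(a)=\widetilde{\Delta}_r(a)=\omega\alpha^{-1}(a)r^1\otimes\beta(r^2)-\alpha(r^1)\otimes r^2\,\psi\beta^{-1}(a)-\lambda(1\otimes\psi(a)).$$ Then $(A,\mu,\widetilde{\Delta}_r,1,\alpha,\beta,\psi,\omega)$ is an anti-quasitriangular unitary $\lambda$-infBH-bialgebra (that is, $r$ satisfies $r_{13}r_{12}-r_{12}r_{23}+r_{23}r_{13}=-\lambda r_{13}$) if and only if $$(\Delta\otimes\psi)(r)=-r_{23}r_{13}-\lambda(r_{23}+r_{13}),$$ and equivalently if and only if $$(\omega\otimes\Delta)(r)=r_{13}r_{12}.$$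
   Context: A BiHom-associative algebra $(A,\mu,\alpha,\beta)$ consists of a vector space $A$ and linear maps $\mu:A\otimes A\to A$ (written $ab$), $\alpha,\beta:A\to A$ with $\alpha\beta=\beta\alpha$, $\alpha(ab)=\alpha(a)\alpha(b)$, $\beta(ab)=\beta(a)\beta(b)$ and $\alpha(a)(bc)=(ab)\beta(c)$. It is unitary with unit $1$ if $\alpha(1)=1=\beta(1)$, $a1=\alpha(a)$, $1a=\beta(a)$ for all $a$. With $r=r^1\otimes r^2=\bar r^1\otimes\bar r^2$ (sums suppressed), in $A\otimes A\otimes A$: $r_{12}r_{23}=\alpha(r^1)\otimes r^2\bar r^1\otimes\beta(\bar r^2)$, $\;r_{13}r_{12}=\omega(r^1)\bar r^1\otimes\beta(\bar r^2)\otimes\alpha\psi(r^2)$, $\;r_{23}r_{13}=\beta\omega(r^1)\otimes\alpha(\bar r^1)\otimes\bar r^2\psi(r^2)$, $\;r_{13}=\omega(r^1)\otimes1\otimes\psi(r^2)$, $\;r_{23}=1\otimes r$. The equation $r_{13}r_{12}-r_{12}r_{23}+r_{23}r_{13}=-\lambda r_{13}$ is the $(-\lambda)$-associative BiHom-Yang-Baxter equation. In the setting of the claim, an anti-quasitriangular unitary $\lambda$-infBH-bialgebra is the data $(A,\mu,1,\alpha,\beta,\psi,\omega,r)$ with $r$ a solution of this equation (its comultiplication being $\widetilde{\Delta}_r$). *)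

(* Defs.v *)
From HB Require Import structures.
From mathcomp Require Import all_boot all_order all_algebra.
From mathcomp Require Import boolp.

Set Implicit Arguments.
Unset Strict Implicit.
Unset Printing Implicit Defensive.

Import GRing.Theory.

Local Open Scope ring_scope.
Local Open Scope quotient_scope.

(* MathComp has no tensor product of infinite-dimensional spaces.  Here it is
   the usual quotient: a formal sum of pure tensors is a list of pairs (scalars
   are absorbed in the first components), taken modulo the congruence generated
   by commutativity of the sum and bilinearity. *)
Section Tensor.
Variables (K : fieldType) (A B : lmodType K).

Inductive tensor_cong : seq (A * B) -> seq (A * B) -> Prop :=
| tcong_refl s : tensor_cong s s
| tcong_sym s t : tensor_cong s t -> tensor_cong t s
| tcong_trans s t u : tensor_cong s t -> tensor_cong t u -> tensor_cong s u
| tcong_cat s s' t t' :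
    tensor_cong s s' -> tensor_cong t t' -> tensor_cong (s ++ t) (s' ++ t')
| tcong_comm s t : tensor_cong (s ++ t) (t ++ s)
| tcong0 b : tensor_cong [:: (0, b)] [::]
| tcongDl a a' b : tensor_cong [:: (a + a', b)] [:: (a, b); (a', b)]
| tcongDr a b b' : tensor_cong [:: (a, b + b')] [:: (a, b); (a, b')]
| tcongZ k a b : tensor_cong [:: (k *: a, b)] [:: (a, k *: b)].

Definition tensor_equiv (s t : seq (A * B)) : bool := `[< tensor_cong s t >].

Lemma tensor_equiv_refl : reflexive tensor_equiv.
Proof. by move=> s; apply/asboolP; apply: tcong_refl. Qed.

Lemma tensor_equiv_sym : symmetric tensor_equiv.
Proof. by move=> s t; apply/asboolP/asboolP; apply: tcong_sym. Qed.

Lemma tensor_equiv_trans : transitive tensor_equiv.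
Proof.
move=> t s u /asboolP st /asboolP tu; apply/asboolP.
exact: tcong_trans st tu.
Qed.

Canonical tensor_equiv_rel :=
  EquivRel tensor_equiv tensor_equiv_refl tensor_equiv_sym tensor_equiv_trans.

Definition tensor := {eq_quot tensor_equiv}.
HB.instance Definition _ := Choice.on tensor.
HB.instance Definition _ := EqQuotient.on tensor.

Lemma tensor_piP s t : tensor_cong s t <-> \pi_tensor s = \pi_tensor t.
Proof.
split=> [st|/eqmodP/asboolP //].
by apply/eqmodP/asboolP.
Qed.

Definition fscale (k : K) (s : seq (A * B)) := [seq (k *: p.1, p.2) | p <- s].

Lemma tcong_scale k s t :
  tensor_cong s t -> tensor_cong (fscale k s) (fscale k t).
Proof.
elim=> {s t} [s|s t _|s t u _ st _ tu|s s' t t' _ ss _ tt|s t|b|a a' b|a b b'|l a b].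
- exact: tcong_refl.
- exact: tcong_sym.
- exact: tcong_trans st tu.
- by rewrite /fscale !map_cat; apply: tcong_cat.
- by rewrite /fscale !map_cat; apply: tcong_comm.
- by rewrite /= scaler0; apply: tcong0.
- by rewrite /= scalerDr; apply: tcongDl.
- exact: tcongDr.
- by rewrite /= scalerA mulrC -scalerA; apply: tcongZ.
Qed.

Lemma tcong_scaleN s : tensor_cong (fscale (-1) s ++ s) [::].
Proof.
elim: s => [|[a b] s IHs] /=; first exact: tcong_refl.
rewrite -cat1s -[(a, b) :: s]cat1s.
apply: (@tcong_trans _ (([:: (-1 *: a, b)] ++ [:: (a, b)]) ++ (fscale (-1) s ++ s))).
  rewrite -catA; apply: tcong_cat; first exact: tcong_refl.
  rewrite !catA; apply: tcong_cat; last exact: tcong_refl.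
  exact: tcong_comm.
rewrite -[X in tensor_cong _ X]/([::] ++ [::]); apply: tcong_cat => //.
apply: tcong_trans (tcong_sym (tcongDl _ _ _)) _.
by rewrite scaleN1r addNr; apply: tcong0.
Qed.

Lemma tcong_scaleDl k l s :
  tensor_cong (fscale (k + l) s) (fscale k s ++ fscale l s).
Proof.
elim: s => [|[a b] s IHs] /=; first exact: tcong_refl.
apply: (@tcong_trans _ ([:: ((k + l) *: a, b)] ++ (fscale k s ++ fscale l s))).
  by rewrite -cat1s; apply: tcong_cat => //; apply: tcong_refl.
apply: (@tcong_trans _ ([:: (k *: a, b); (l *: a, b)] ++ (fscale k s ++ fscale l s))).
  by apply: tcong_cat (tcong_refl _); rewrite scalerDl; apply: tcongDl.
rewrite -[[:: _; _]]/([:: (k *: a, b)] ++ [:: (l *: a, b)]) -catA.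
rewrite -[X in tensor_cong _ X]/([:: (k *: a, b)] ++ (fscale k s ++ ([:: (l *: a, b)] ++ fscale l s))).
apply: tcong_cat; first exact: tcong_refl.
rewrite !catA; apply: tcong_cat; last exact: tcong_refl.
exact: tcong_comm.
Qed.

Definition tensor_add (x y : tensor) : tensor := \pi_tensor (repr x ++ repr y).
Definition tensor_scale (k : K) (x : tensor) : tensor :=
  \pi_tensor (fscale k (repr x)).
Definition tensor_zero : tensor := \pi_tensor [::].
Definition tensor_opp : tensor -> tensor := tensor_scale (-1).

Lemma tcong_repr s : tensor_cong (repr (\pi_tensor s)) s.
Proof. by apply/tensor_piP; rewrite reprK. Qed.

Lemma pi_tensor_add s t :
  tensor_add (\pi_tensor s) (\pi_tensor t) = \pi_tensor (s ++ t).
Proof. by apply/tensor_piP; apply: tcong_cat; apply: tcong_repr. Qed.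

Lemma pi_tensor_scale k s :
  tensor_scale k (\pi_tensor s) = \pi_tensor (fscale k s).
Proof. by apply/tensor_piP; apply: tcong_scale; apply: tcong_repr. Qed.

Lemma tensor_addA : associative tensor_add.
Proof.
elim/quotW=> s; elim/quotW=> t; elim/quotW=> u.
rewrite (pi_tensor_add t u) (pi_tensor_add s t).
by rewrite (pi_tensor_add s (t ++ u)) (pi_tensor_add (s ++ t) u) catA.
Qed.

Lemma tensor_addC : commutative tensor_add.
Proof. by move=> x y; apply/tensor_piP/tcong_comm. Qed.

Lemma tensor_add0 : left_id tensor_zero tensor_add.
Proof. by elim/quotW=> s; rewrite (pi_tensor_add [::] s). Qed.

Lemma tensor_addN : left_inverse tensor_zero tensor_opp tensor_add.
Proof.
elim/quotW=> s; rewrite /tensor_opp pi_tensor_scale pi_tensor_add.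
exact/tensor_piP/tcong_scaleN.
Qed.

HB.instance Definition _ := GRing.isZmodule.Build tensor
  tensor_addA tensor_addC tensor_add0 tensor_addN.

Lemma tensor_scaleA k l x :
  tensor_scale k (tensor_scale l x) = tensor_scale (k * l) x.
Proof.
elim/quotW: x => s; rewrite (pi_tensor_scale l s) (pi_tensor_scale k (fscale l s)).
rewrite (pi_tensor_scale (k * l) s).
suff -> : fscale k (fscale l s) = fscale (k * l) s by [].
by rewrite /fscale -map_comp; apply: eq_map => p; rewrite /= scalerA.
Qed.

Lemma tensor_scale1 : left_id 1 tensor_scale.
Proof.
elim/quotW=> s; rewrite pi_tensor_scale; suff -> : fscale 1 s = s by [].
by rewrite /fscale -[RHS]map_id; apply: eq_map => -[a b] /=; rewrite scale1r.
Qed.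

Lemma tensor_scaleDr : right_distributive tensor_scale +%R.
Proof.
move=> k; elim/quotW=> s; elim/quotW=> t.
rewrite [_ + _]pi_tensor_add (pi_tensor_scale k (s ++ t)).
rewrite (pi_tensor_scale k s) (pi_tensor_scale k t) [RHS]pi_tensor_add.
by rewrite /fscale map_cat.
Qed.

Lemma tensor_scaleDl x : {morph tensor_scale^~ x : k l / k + l}.
Proof.
move=> k l; elim/quotW: x => s.
rewrite (pi_tensor_scale (k + l)) (pi_tensor_scale k) (pi_tensor_scale l) [RHS]pi_tensor_add.
exact/tensor_piP/tcong_scaleDl.
Qed.

HB.instance Definition _ := GRing.Zmodule_isLmodule.Build K tensor
  tensor_scaleA tensor_scale1 tensor_scaleDr tensor_scaleDl.

Definition tens (a : A) (b : B) : tensor := \pi_tensor [:: (a, b)].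

Lemma tensDl a a' b : tens (a + a') b = tens a b + tens a' b.
Proof. by rewrite [RHS]pi_tensor_add; apply/tensor_piP; apply: tcongDl. Qed.

Lemma tensDr a b b' : tens a (b + b') = tens a b + tens a b'.
Proof. by rewrite [RHS]pi_tensor_add; apply/tensor_piP; apply: tcongDr. Qed.

Lemma tensZl k a b : tens (k *: a) b = k *: tens a b.
Proof. by rewrite [RHS]pi_tensor_scale. Qed.

Lemma tensZr k a b : tens a (k *: b) = k *: tens a b.
Proof. by rewrite -tensZl; apply/esym/tensor_piP; apply: tcongZ. Qed.

Lemma tensor_repr_sum x : x = \sum_(p <- repr x) tens p.1 p.2.
Proof.
rewrite -{1}[x]reprK; elim: (repr x) => [|[a b] s IHs]; first by rewrite big_nil.
by rewrite big_cons -IHs [RHS]pi_tensor_add.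
Qed.

End Tensor.

Notation "a ⊗ b" := (tens a b) (at level 38, right associativity) : ring_scope.

(* The "Sweedler sum" of f r1 r2 over x = r1 ⊗ r2.  When f is bilinear
   it does not depend on the decomposition of x into pure tensors, and it is the
   linear map induced by f (see the lemmas below).  It is only used for
   such f. *)
Definition tlift (K : fieldType) (A B W : lmodType K) (f : A -> B -> W)
  (x : tensor A B) : W := \sum_(p <- repr x) f p.1 p.2.

Section TensorLift.
Variables (K : fieldType) (A B W : lmodType K) (f : A -> B -> W).
Hypothesis fl : forall b, linear (f^~ b).
Hypothesis fr : forall a, linear (f a).

Lemma tlift_cong s t : tensor_cong s t ->
  \sum_(p <- s) f p.1 p.2 = \sum_(p <- t) f p.1 p.2.
Proof.
have f0 b : f 0 b = 0 by have := fl b (-1) 0 0; rewrite scaler0 addr0 scaleN1r addNr.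
have fr0 a : f a 0 = 0 by have := fr a (-1) 0 0; rewrite scaler0 addr0 scaleN1r addNr.
elim=> {s t} [s|s t _|s t u _ st _ tu|s s' t t' _ ss _ tt|s t|b|a a' b|a b b'|k a b] //.
- by rewrite st.
- by rewrite !big_cat /= ss tt.
- by rewrite !big_cat /= addrC.
- by rewrite big_seq1 big_nil /= f0.
- by rewrite big_seq1 big_cons big_seq1 /= -[a]scale1r fl !scale1r.
- by rewrite big_seq1 big_cons big_seq1 /= -[b]scale1r fr !scale1r.
- rewrite !big_seq1 /= -[k *: a]addr0 -[k *: b]addr0.
  by rewrite fl fr f0 fr0.
Qed.

Lemma tlift_tens a b : tlift f (a ⊗ b) = f a b.
Proof.
by rewrite /tlift (tlift_cong (tcong_repr [:: (a, b)])) big_seq1.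
Qed.

Lemma tlift_is_linear : linear (tlift f).
Proof.
have fZ k a b : f (k *: a) b = k *: f a b.
  have := fl b k a 0; rewrite !addr0 => ->.
  by have := fl b (-1) 0 0; rewrite scaler0 addr0 scaleN1r addNr => ->; rewrite addr0.
move=> k x y.
have -> : k *: x + y = \pi_(tensor A B) (fscale k (repr x) ++ repr y).
  by rewrite -(pi_tensor_add (fscale k (repr x)) (repr y)) (reprK y).
rewrite /tlift (tlift_cong (tcong_repr _)) big_cat /= scaler_sumr big_map.
by congr (_ + _); apply: eq_bigr => p _; rewrite /= fZ.
Qed.

Lemma tlift_unique (g : {linear tensor A B -> W}) :
  (forall a b, g (a ⊗ b) = f a b) -> g =1 tlift f.
Proof.
move=> gf x; rewrite {1}[x]tensor_repr_sum linear_sum.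
by apply: eq_bigr => p _; rewrite gf.
Qed.

End TensorLift.

Definition tmap (K : fieldType) (A B C D : lmodType K)
    (f : A -> C) (g : B -> D) : tensor A B -> tensor C D :=
  tlift (fun a b => f a ⊗ g b).

Definition tassoc (K : fieldType) (A B C : lmodType K) :
    tensor (tensor A B) C -> tensor A (tensor B C) :=
  tlift (fun x c => tlift (fun a b => a ⊗ b ⊗ c) x).

Section BiHom.
Variables (K : fieldType) (A : lmodType K).
Variables (mu : {linear tensor A A -> A}) (one : A).
Variables (alpha beta psi omega : {linear A -> A}).

Local Notation "a ∙ b" := (mu (a ⊗ b)) (at level 37, left associativity).

Record BiHom_associative : Prop := {
  bihom_comm : forall a, alpha (beta a) = beta (alpha a);
  bihom_alphaM : forall a b, alpha (a ∙ b) = alpha a ∙ alpha b;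
  bihom_betaM : forall a b, beta (a ∙ b) = beta a ∙ beta b;
  bihom_assoc : forall a b c, alpha a ∙ (b ∙ c) = (a ∙ b) ∙ beta c }.

Record unitary_BiHom_associative : Prop := {
  bihom_algebra : BiHom_associative;
  bihom_alpha1 : alpha one = one;
  bihom_beta1 : beta one = one;
  bihom_mulr1 : forall a, a ∙ one = alpha a;
  bihom_mul1r : forall a, one ∙ a = beta a }.

Variable r : tensor A A.

Definition r13 : tensor A (tensor A A) :=
  tlift (fun r1 r2 => omega r1 ⊗ one ⊗ psi r2) r.

Definition r23 : tensor A (tensor A A) := one ⊗ r.

(* In the three products below, r1 ⊗ r2 and s1 ⊗ s2 are two copies of r. *)
Definition r12r23 : tensor A (tensor A A) :=
  tlift (fun r1 r2 =>
    tlift (fun s1 s2 => alpha r1 ⊗ (r2 ∙ s1) ⊗ beta s2) r) r.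

Definition r13r12 : tensor A (tensor A A) :=
  tlift (fun r1 r2 =>
    tlift (fun s1 s2 => (omega r1 ∙ s1) ⊗ beta s2 ⊗ alpha (psi r2)) r) r.

Definition r23r13 : tensor A (tensor A A) :=
  tlift (fun r1 r2 =>
    tlift (fun s1 s2 => beta (omega r1) ⊗ alpha s1 ⊗ (s2 ∙ psi r2)) r) r.

Definition assoc_BiHom_YBE (nu : K) : Prop :=
  r13r12 - r12r23 + r23r13 = nu *: r13.

Definition anti_quasitriangular (lambda : K) : Prop :=
  assoc_BiHom_YBE (- lambda).

(* alphaV and betaV stand for the inverses of alpha and beta. *)
Definition Delta_r (lambda : K) (alphaV betaV : A -> A) (a : A) : tensor A A :=
  tlift (fun r1 r2 => (omega (alphaV a) ∙ r1) ⊗ beta r2) r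
  - tlift (fun r1 r2 => alpha r1 ⊗ (r2 ∙ psi (betaV a))) r
  - lambda *: (one ⊗ psi a).

End BiHom.

(* Main.v *)
(* Writing r = r^1 ⊗ r^2 and using the invariance of r under alpha (resp. beta)
   to absorb the inverse alpha^-1 (resp. beta^-1), and then its invariance under
   psi and omega, the definition of Delta gives, for every r,
     (Delta ⊗ psi)(r) = r13 r12 - r12 r23 - lambda r23,
     (omega ⊗ Delta)(r) = r12 r23 - r23 r13 - lambda r13.
   Each of the two conditions is thus a rearrangement of the Yang-Baxter
   equation. *)
Require Import Defs.
From HB Require Import structures.
From mathcomp Require Import all_boot all_order all_algebra.
Import GRing.Theory.
Local Open Scope ring_scope.

Section TensorLiftTheory.
Variables (K : fieldType) (A B : lmodType K).

(** [tlift f x] is a finite sum over a fixed representative of [x], so [L] moves inside termwise.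
    Linearity is an explicit argument because [L] will be an unbundled map such as [tassoc] or
    another [tlift]. *)
Lemma linear_tlift {U V : lmodType K} {L : U -> V} (Llin : linear L)
    (f : A -> B -> U) x :
  L (tlift f x) = tlift (fun a b => L (f a b)) x.
Proof.
pose L' : {linear U -> V} := HB.pack L (GRing.isLinear.Build K U V _ L Llin).
exact: (linear_sum L').
Qed.

Lemma eq_tlift (W : lmodType K) (f g : A -> B -> W) x :
  (forall a b, f a b = g a b) -> tlift f x = tlift g x.
Proof. by move=> fg; apply: eq_bigr => p _; apply: fg. Qed.

Lemma tliftB (W : lmodType K) (f g : A -> B -> W) x :
  tlift (fun a b => f a b - g a b) x = tlift f x - tlift g x.
Proof. exact: sumrB. Qed.

Lemma tliftZ (W : lmodType K) k (f : A -> B -> W) x :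
  tlift (fun a b => k *: f a b) x = k *: tlift f x.
Proof. by rewrite /tlift scaler_sumr. Qed.

(** With two copies of [r], the inner sum depends linearly on each leg of the outer one; this yields
    the side conditions of [tlift_tmap] for nested sums. *)
Lemma tlift_linear_param (U W : lmodType K) (f : U -> A -> B -> W) x :
  (forall a b, linear (fun u => f u a b)) -> linear (fun u => tlift (f u) x).
Proof.
move=> flin k u v; rewrite -tliftZ /tlift -big_split.
by apply: eq_bigr => p _; apply: flin.
Qed.

(** This is how invariance of [r] is exploited: writing [r] as [tmap g g r] substitutes [g r1] and
    [g r2] for its legs. Bilinearity of [f] is essential, since the representative of [tmap g h x]
    is not the image of that of [x]. *)
Lemma tlift_tmap (C D W : lmodType K) (g : A -> C) (h : B -> D)
    (f : C -> D -> W) x :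
    (forall d, linear (f^~ d)) -> (forall c, linear (f c)) ->
  tlift f (tmap g h x) = tlift (fun a b => f (g a) (h b)) x.
Proof.
move=> fl fr; rewrite /tmap (linear_tlift (@tlift_is_linear _ _ _ _ _ fl fr)).
by apply: eq_tlift => a b; apply: tlift_tens.
Qed.

Lemma tens_linearr (a : A) : linear (@tens K A B a).
Proof. by move=> k x y; rewrite tensDr tensZr. Qed.

End TensorLiftTheory.

Arguments linear_tlift {K A B U V L} Llin f x.

(** Both sides say that one and the same difference vanishes. *)
Lemma eq_iff_subr (V : zmodType) (a b c d : V) :
  a - b = c - d -> (a = b <-> c = d).
Proof.
move=> eq_sub; split=> /eqP; rewrite -subr_eq0.
  by rewrite eq_sub subr_eq0 => /eqP.
by rewrite -eq_sub subr_eq0 => /eqP.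
Qed.

Lemma tassoc_tensl_linear (K : fieldType) (A B C : lmodType K) (c : C) :
  linear (tlift (fun (a : A) (b : B) => a ⊗ b ⊗ c)).
Proof.
by apply: tlift_is_linear => [b|a] k u v; rewrite ?tensDl ?tensDr ?tensZl ?tensZr.
Qed.

Lemma tassoc_tensr_linear (K : fieldType) (A B C : lmodType K) (x : tensor A B) :
  linear (fun c : C => tlift (fun a b => a ⊗ b ⊗ c) x).
Proof.
by apply: tlift_linear_param => a b k u v; rewrite !tensDr !tensZr.
Qed.

Lemma tassoc_tens (K : fieldType) (A B C : lmodType K) (x : tensor A B) (c : C) :
  tassoc (x ⊗ c) = tlift (fun a b => a ⊗ b ⊗ c) x.
Proof.
rewrite /tassoc tlift_tens // => [?|?].
  exact: tassoc_tensl_linear.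
exact: tassoc_tensr_linear.
Qed.

Lemma tassoc_is_linear (K : fieldType) (A B C : lmodType K) :
  linear (@tassoc K A B C).
Proof.
apply: tlift_is_linear => ?; first exact: tassoc_tensl_linear.
exact: tassoc_tensr_linear.
Qed.

Section DeltaTensor.
Variables (K : fieldType) (lambda : K) (A : lmodType K).
Variables (mu : {linear tensor A A -> A}) (one : A).
Variables (alpha beta psi omega alphaV betaV : {linear A -> A}).
Variable r : tensor A A.
Hypotheses (alphaK : cancel alpha alphaV) (betaK : cancel beta betaV).
Hypotheses (r_alpha : tmap alpha alpha r = r) (r_beta : tmap beta beta r = r).
Hypotheses (r_psi : tmap psi psi r = r) (r_omega : tmap omega omega r = r).

Let Delta := Delta_r mu one alpha beta psi omega r lambda alphaV betaV.

Local Ltac multilin :=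
  by move=> * k u v; rewrite !(linearP, tensDl, tensDr, tensZl, tensZr).

Local Ltac multilin_tlift := move=> *; first
  [ multilin | apply: tlift_linear_param; multilin ].

Lemma tmap_Delta_psi : (forall a, alpha (psi a) = psi (alpha a)) ->
    (forall a, beta (psi a) = psi (beta a)) ->
  tassoc (tmap Delta psi r) =
    r13r12 mu alpha beta psi omega r - r12r23 mu alpha beta r
    - lambda *: r23 one r.
Proof.
move=> alpha_psi beta_psi.
rewrite /tmap (linear_tlift (@tassoc_is_linear _ _ _ _)).
(* Expand [Delta] on the first leg and reassociate each of its three terms. *)
transitivity (tlift (fun r1 r2 =>
    tlift (fun s1 s2 => mu (omega (alphaV r1) ⊗ s1) ⊗ beta s2 ⊗ psi r2) r
    - tlift (fun s1 s2 => alpha s1 ⊗ mu (s2 ⊗ psi (betaV r1)) ⊗ psi r2) r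
    - lambda *: (one ⊗ psi r1 ⊗ psi r2)) r).
  apply: eq_tlift => r1 r2; rewrite tassoc_tens /Delta /Delta_r.
  have Tlin : linear (tlift (fun a b : A => a ⊗ b ⊗ psi r2)).
    exact: tassoc_tensl_linear.
  pose T : {linear tensor A A -> _} :=
    HB.pack (tlift (fun a b : A => a ⊗ b ⊗ psi r2))
      (GRing.isLinear.Build _ _ _ _ _ Tlin).
  rewrite -[LHS]/(T _) !linearB linearZ /= !(linear_tlift Tlin).
  by congr (_ - _ - _ *: _); first [apply: eq_tlift => s1 s2 | idtac];
    rewrite tlift_tens //; multilin.
rewrite !tliftB tliftZ; congr (_ - _ - _ *: _).
(* Only the outer copy of [r] is replaced: its first leg cancels [alphaV], and its second acquires
   the [alpha] present in [r13r12]. *)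
- rewrite -{2}r_alpha tlift_tmap; try multilin_tlift.
  apply: eq_tlift => r1 r2; apply: eq_tlift => s1 s2.
  by rewrite alphaK alpha_psi.
- rewrite -{2}r_beta tlift_tmap; try multilin_tlift.
  (* Once [betaV] is cancelled, [psi] acts on both legs of the outer copy and is absorbed by
     [r_psi]. *)
  transitivity (tlift (fun r1 r2 =>
      tlift (fun s1 s2 => alpha s1 ⊗ mu (s2 ⊗ r1) ⊗ beta r2) r) (tmap psi psi r)).
    rewrite tlift_tmap; try multilin_tlift.
    by apply: eq_tlift => r1 r2; apply: eq_tlift => s1 s2; rewrite betaK beta_psi.
  (* The inner copy carries the leftmost factor, whereas in [r12r23] the outer one does, so the two
     sums are exchanged. *)
  by rewrite r_psi; exact: exchange_big.
- rewrite /r23 -{2}r_psi /tmap (linear_tlift (@tens_linearr _ _ _ one)).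
  exact: eq_tlift.
Qed.

Lemma tmap_omega_Delta : (forall a, alpha (omega a) = omega (alpha a)) ->
    (forall a, beta (omega a) = omega (beta a)) ->
  tmap omega Delta r =
    r12r23 mu alpha beta r - r23r13 mu alpha beta psi omega r
    - lambda *: r13 one psi omega r.
Proof.
move=> alpha_omega beta_omega.
transitivity (tlift (fun r1 r2 =>
    tlift (fun s1 s2 => omega r1 ⊗ mu (omega (alphaV r2) ⊗ s1) ⊗ beta s2) r
    - tlift (fun s1 s2 => omega r1 ⊗ alpha s1 ⊗ mu (s2 ⊗ psi (betaV r2))) r
    - lambda *: (omega r1 ⊗ one ⊗ psi r2)) r).
  apply: eq_tlift => r1 r2; rewrite /Delta /Delta_r.
  have Tlin := @tens_linearr K A (tensor A A) (omega r1).
  pose T : {linear tensor A A -> _} :=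
    HB.pack (tens (omega r1)) (GRing.isLinear.Build _ _ _ _ _ Tlin).
  by rewrite -[LHS]/(T _) !linearB linearZ /= !(linear_tlift Tlin).
(* The third terms agree by definition of [r13], which leaves two goals. *)
rewrite !tliftB tliftZ; congr (_ - _ - _).
- rewrite -{2}r_alpha tlift_tmap; try multilin_tlift.
  transitivity (tlift (fun r1 r2 =>
      tlift (fun s1 s2 => alpha r1 ⊗ mu (r2 ⊗ s1) ⊗ beta s2) r) (tmap omega omega r)).
    rewrite tlift_tmap; try multilin_tlift.
    by apply: eq_tlift => r1 r2; apply: eq_tlift => s1 s2; rewrite alphaK alpha_omega.
  by rewrite r_omega.
- rewrite -{2}r_beta tlift_tmap; try multilin_tlift.
  by apply: eq_tlift => r1 r2; apply: eq_tlift => s1 s2; rewrite betaK beta_omega.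
Qed.

End DeltaTensor.

Theorem proposition3p17 (K : fieldType) (lambda : K) (A : lmodType K)
    (mu : {linear tensor A A -> A}) (one : A)
    (alpha beta psi omega : {linear A -> A})
    (alphaV betaV : A -> A) (r : tensor A A)
    (hA : unitary_BiHom_associative mu one alpha beta)
    (alphaK : cancel alpha alphaV) (alphaVK : cancel alphaV alpha)
    (betaK : cancel beta betaV) (betaVK : cancel betaV beta)
    (h_alpha_psi : forall a, alpha (psi a) = psi (alpha a))
    (h_alpha_omega : forall a, alpha (omega a) = omega (alpha a))
    (h_beta_psi : forall a, beta (psi a) = psi (beta a))
    (h_beta_omega : forall a, beta (omega a) = omega (beta a))
    (h_psi_omega : forall a, psi (omega a) = omega (psi a))
    (psiM : forall a b, psi (mu (a ⊗ b)) = mu (psi a ⊗ psi b))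
    (omegaM : forall a b, omega (mu (a ⊗ b)) = mu (omega a ⊗ omega b))
    (psi1 : psi one = one) (omega1 : omega one = one)
    (r_alpha : tmap alpha alpha r = r) (r_beta : tmap beta beta r = r)
    (r_psi : tmap psi psi r = r) (r_omega : tmap omega omega r = r) :
  let Delta := Delta_r mu one alpha beta psi omega r lambda alphaV betaV in
  (anti_quasitriangular mu one alpha beta psi omega r lambda <->
    tassoc (tmap Delta psi r) =
      - r23r13 mu alpha beta psi omega r
      - lambda *: (r23 one r + r13 one psi omega r)) /\
  (anti_quasitriangular mu one alpha beta psi omega r lambda <->
    tmap omega Delta r = r13r12 mu alpha beta psi omega r).
Proof.
(* The inverse of a linear bijection is linear; the expansions of [Delta] above require it
   bundled. *)
pose aV : {linear A -> A} :=
  HB.pack alphaV (GRing.isLinear.Build _ _ _ _ _ (can2_linear alphaK alphaVK)).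
pose bV : {linear A -> A} :=
  HB.pack betaV (GRing.isLinear.Build _ _ _ _ _ (can2_linear betaK betaVK)).
move=> Delta.
rewrite (@tmap_Delta_psi _ _ _ _ _ _ _ _ _ aV bV) //.
rewrite (@tmap_omega_Delta _ _ _ _ _ _ _ _ _ aV bV) //.
rewrite /anti_quasitriangular /assoc_BiHom_YBE.
move: (r13r12 _ _ _ _ _ _) (r12r23 _ _ _ _) (r23r13 _ _ _ _ _ _) => x y z.
rewrite scaleNr scalerDr.
move: (lambda *: r13 _ _ _ _) (lambda *: r23 _ _) => u v.
split.
  (* Both differences equal [x - y + z + u]: the two occurrences of [v] cancel. *)
  apply: eq_iff_subr; rewrite !opprD !opprK !addrA.
  by rewrite (addrAC _ (- v) z) subrK.
(* The second condition is turned around so that the differences agree rather than being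
   opposite. *)
have h : x - y + z = - u <-> x = y - z - u.
  by apply: eq_iff_subr; rewrite !opprD !opprK !addrA.
by split=> [/h | e]; last exact/h.
Qed.
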